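(* There exists a $(9,108)$-strategy for the GKS game; that is, in the GKS game with parameters $n=108$ and $k=9$, Alice and Bob have a strategy that wins against every behavior of Merlin.
   Context: The GKS game with parameters $n,k$ is played by Alice and Bob (a team, who may agree on a strategy beforehand but cannot communicate during play) against Merlin. A string $x\in\{0,1\}^n$ is initially empty. Merlin chooses an arbitrary ordering (permutation) of the positions $\{1,\dots,n\}$ and reveals the positions to Alice one at a time in that order. When Alice receives a position $i$ (among the first $n-1$ revealed positions), she must immediately choose the bit $x_i$, knowing only the positions revealed so far (and the bits she has already chosen). The last remaining position is filled with a bit of Merlin's choice. The completed string $x$ is then given to Bob, who (knowing only $x$) outputs a set $S$ of $k$ positions. Alice and Bob win if $S$ contains the position filled by Merlin. A winning strategy for Alice and Bob in this game (i.e. one that wins for every ordering and every choice of the last bit by Merlin) is called a $(k,n)$-strategy. The cost of the $n$-game is the minimal $k$ for which a $(k,n)$-strategy exists. *)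

(* Defs.v *)
From mathcomp Require Import all_boot all_fingroup.
Set Implicit Arguments. Unset Strict Implicit. Unset Printing Implicit Defensive.

(* Positions are 'I_n.  Merlin's ordering is a permutation p : {perm 'I_n};
   at step t (0-based) the position p t is revealed.  An Alice strategy maps
   the history of revealed positions [p 0; ...; p t] (the last entry being the
   current position) to the bit she writes there.  (Her own previous bits are a
   function of this history, so this is no loss of generality.) *)
Definition alice_strategy (n : nat) := seq 'I_n -> bool.
Definition bob_strategy (n : nat) := {ffun 'I_n -> bool} -> {set 'I_n}.

Definition history (n : nat) (p : {perm 'I_n}) (t : nat) : seq 'I_n :=
  map p (take t.+1 (enum 'I_n)).

(* the completed string: the position revealed at the last step n-1 gets
   Merlin's bit b; every other position gets Alice's bit *)
Definition gks_string (n : nat) (A : alice_strategy n) (p : {perm 'I_n})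
    (b : bool) : {ffun 'I_n -> bool} :=
  [ffun i => let t := nat_of_ord ((p^-1)%g i) in
             if t == n.-1 then b else A (history p t)].

Definition winning_strategy (k n : nat) (A : alice_strategy n) (B : bob_strategy n) :=
  (forall x, #|B x| = k) /\
  forall (p : {perm 'I_n}) (b : bool) (i : 'I_n),
    nat_of_ord ((p^-1)%g i) = n.-1 -> i \in B (gks_string A p b).

Definition has_strategy (k n : nat) :=
  exists (A : alice_strategy n) (B : bob_strategy n), winning_strategy k A B.

(* Main.v *)
Require Import Defs.
From mathcomp Require Import all_boot all_fingroup.
Set Implicit Arguments. Unset Strict Implicit. Unset Printing Implicit Defensive.

(* Split the positions into k blocks of size m = k + r.  To every r-subset T of
   a block attach a word phi T vanishing on T, these words being pairwise at
   distance at least 3.  In each block Alice writes 0 on the first r positions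
   revealed, which form a set T, then copies phi T, except that she flips the
   last bit of the block.  A block she completes is thus at distance exactly 1
   from the code, at a position that Bob can decode.  If Merlin's bit puts his
   block on a codeword phi T, Bob recognises the block and answers with the k
   positions outside T; otherwise every block is at distance 1 from the code
   and Bob answers with the k decoded positions, one per block.

   For k = 9 and r = 3, the shortened Hamming code of length 12 has 256 words at
   pairwise distance at least 3, and the 220 triples are matched greedily with
   distinct codewords vanishing on them. *)

(** * Single-bit flips and Hamming distance *)

Definition flip (m : nat) (u : 'I_m) (y : {ffun 'I_m -> bool}) :
    {ffun 'I_m -> bool} :=
  [ffun v => y v (+) (v == u)].

Lemma card_diff_flip (m : nat) (y : {ffun 'I_m -> bool}) (u : 'I_m) :
  #|[set v | y v != flip u y v]| = 1.
Proof.
rewrite -(cards1 u); apply: eq_card => v.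
by rewrite !inE ffunE; case: (y v); case: (v == u).
Qed.

(** Away from [u] and [v] neither flip acts, so the words agree there. *)
Lemma card_diff_flip2 (m : nat) (y z : {ffun 'I_m -> bool}) (u v : 'I_m) :
  flip u y = flip v z -> #|[set w | y w != z w]| <= 2.
Proof.
move=> eq_flip; have sub: [set w | y w != z w] \subset [set u; v].
  apply/subsetP=> w; move/ffunP/(_ w): eq_flip; rewrite !inE !ffunE.
  by case: (w == u); case: (w == v); case: (y w); case: (z w).
by apply: leq_trans (subset_leq_card sub) _; rewrite cards2; case: (u != v).
Qed.

(** * The block strategies of Alice and Bob *)

Section Blocks.

Variables (k r : nat) (phi : {set 'I_(k + r)} -> {ffun 'I_(k + r) -> bool}).
Local Notation m := (k + r).
Hypothesis k_gt0 : 0 < k.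
Hypothesis phi_vanish :
  forall T : {set 'I_m}, #|T| = r -> {in T, forall i, phi T i = false}.
Hypothesis phi_dist : forall T T' : {set 'I_m}, #|T| = r -> #|T'| = r ->
  T != T' -> 2 < #|[set i | phi T i != phi T' i]|.

Let pos_block (i : 'I_(k * m)) : 'I_k * 'I_m :=
  enum_val (cast_ord (esym (etrans (card_prod _ _)
    (f_equal2 muln (card_ord k) (card_ord m)))) i).

Let pos_block_inj : injective pos_block.
Proof. by move=> i j /enum_val_inj/cast_ord_inj. Qed.

Let pos_block_bij : bijective pos_block.
Proof. by apply: inj_card_bij => //; rewrite card_prod !card_ord. Qed.

Let reveal (beta : 'I_k) (h : seq 'I_(k * m)) : seq 'I_m :=
  [seq (pos_block i).2 | i <- h & (pos_block i).1 == beta].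

(** The current position is [last i h'], and [s] already includes its coordinate. Hence
    [size s <= r] holds on exactly the first [r] positions of a block, and [size s == m] only on its
    last one. *)
Let alice (h : seq 'I_(k * m)) : bool :=
  if h is i :: h' then
    let: (beta, u) := pos_block (last i h') in
    let s := reveal beta h in
    if size s <= r then false
    else phi [set v in take r s] u (+) (size s == m)
  else false.

Let block (x : {ffun 'I_(k * m) -> bool}) (beta : 'I_k) : {ffun 'I_m -> bool} :=
  [ffun u => [exists i, (pos_block i == (beta, u)) && x i]].

Let blockE x i : block x (pos_block i).1 (pos_block i).2 = x i.
Proof.
rewrite ffunE -surjective_pairing; apply/existsP/idP => [[j]|xi].
  by case/andP=> /eqP/pos_block_inj->.
by exists i; rewrite eqxx.
Qed.

Let dflt : 'I_m.
Proof. by exists 0; rewrite addn_gt0 k_gt0. Defined.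

(** The default is reached only on words that are not one flip away from a codeword. *)
Let decode (y : {ffun 'I_m -> bool}) : 'I_m :=
  odflt dflt [pick u | [exists T : {set 'I_m}, (#|T| == r) && (y == flip u (phi T))]].

Let bob (x : {ffun 'I_(k * m) -> bool}) : {set 'I_(k * m)} :=
  if [pick bT : 'I_k * {set 'I_m} | (#|bT.2| == r) && (block x bT.1 == phi bT.2)]
    is Some bT then
    [set i | ((pos_block i).1 == bT.1) && ((pos_block i).2 \notin bT.2)]
  else [set i | (pos_block i).2 == decode (block x (pos_block i).1)].

Let phi_inj (T T' : {set 'I_m}) :
  #|T| = r -> #|T'| = r -> phi T = phi T' -> T = T'.
Proof.
move=> hT hT' eq_phi; apply/eqP/contraT => neqT.
have := phi_dist hT hT' neqT; rewrite eq_phi eq_card0 // => v.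
by rewrite !inE eqxx.
Qed.

(** The flipped word is at distance 1 from [phi T], whereas a codeword is at distance 0 or at least
    3 from it. *)
Let flip_not_code (T T' : {set 'I_m}) u :
  #|T| = r -> #|T'| = r -> flip u (phi T) != phi T'.
Proof.
move=> hT hT'; apply/eqP=> eq_flip; have := card_diff_flip (phi T) u.
rewrite eq_flip => card1; have [eqT|neqT] := eqVneq T T'.
  by move: card1; rewrite eqT eq_card0 // => v; rewrite !inE eqxx.
by have := phi_dist hT hT' neqT; rewrite card1.
Qed.

(** Two codewords with a common one-flip neighbour would be at distance at most 2, so the codeword
    is unique, and then so is the flipped position. *)
Let decode_flip (T : {set 'I_m}) u :
  #|T| = r -> decode (flip u (phi T)) = u.
Proof.
move=> hT; rewrite /decode; case: pickP => [v|/(_ u)/existsP[]]; last first.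
  by exists T; rewrite hT !eqxx.
case/existsP=> T' /andP[/eqP hT' /eqP eq_flip] /=.
have eqT: T = T'.
  apply/eqP/contraT => /(phi_dist hT hT').
  by rewrite ltnNge (card_diff_flip2 eq_flip).
move/ffunP/(_ u): eq_flip; rewrite eqT !ffunE eqxx => /addbI.
by move/esym/eqP.
Qed.

Let card_bob x : #|bob x| = k.
Proof.
(* Cardinalities are moved through the bijection [pos_block] and computed on pairs. *)
have card_pos (P : pred ('I_k * 'I_m)) : #|[set i | P (pos_block i)]| = #|P|.
  rewrite -(card_image pos_block_inj); apply: eq_card => bu.
  have [g fK gK] := pos_block_bij.
  apply/imageP/idP => [[i]|Pbu]; first by rewrite inE => Pi ->.
  by exists (g bu); rewrite ?inE gK.
rewrite /bob; case: pickP => [[beta T] /= /andP[/eqP hT _]|_].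
  rewrite (card_pos [pred bu | (bu.1 == beta) && (bu.2 \notin T)]).
  rewrite (@eq_card _ _ (setX [set beta] (~: T))) => [|bu]; last by rewrite !inE.
  by rewrite cardsX cards1 mul1n cardsCs setCK hT card_ord addnK.
rewrite (card_pos [pred bu | bu.2 == decode (block x bu.1)]).
rewrite -[RHS]card_ord -(@card_image _ _ (fun b : 'I_k => (b, decode (block x b)))).
  apply: eq_card => -[beta u]; rewrite inE /=.
  apply/eqP/imageP => [->|[b _ [-> ->]]] //; by exists beta.
exact: (can_inj (g := fst)).
Qed.

(** * Analysis of a single play *)

Section Play.

Variables (p : {perm 'I_(k * m)}) (b : bool) (i0 : 'I_(k * m)).
Hypothesis i0_last : nat_of_ord ((p^-1)%g i0) = (k * m).-1.

Let order : seq 'I_(k * m) := map p (enum 'I_(k * m)).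
Let rho beta := reveal beta order.
Let T beta : {set 'I_m} := [set v in take r (rho beta)].
Let x := gks_string alice p b.

Let size_order : size order = k * m.
Proof. by rewrite size_map size_enum_ord. Qed.

Let order_uniq : uniq order.
Proof. by rewrite map_inj_uniq ?enum_uniq //; exact: perm_inj. Qed.

Let mem_order i : i \in order.
Proof. by rewrite -(permKV p i) map_f ?mem_enum. Qed.

Let rho_uniq beta : uniq (rho beta).
Proof.
rewrite map_inj_in_uniq ?filter_uniq // => i j.
rewrite !mem_filter => /andP[/eqP hi _] /andP[/eqP hj _] eq2.
by apply: pos_block_inj; rewrite [LHS]surjective_pairing hi eq2 -hj -surjective_pairing.
Qed.

Let mem_rho beta u : u \in rho beta.
Proof.
have [g fK gK] := pos_block_bij.
apply/mapP; exists (g (beta, u)); rewrite ?gK //.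
by rewrite mem_filter gK eqxx mem_order.
Qed.

Let size_rho beta : size (rho beta) = m.
Proof.
by rewrite -(card_uniqP (rho_uniq beta)) -[RHS]card_ord; apply: eq_card => u;
  rewrite mem_rho.
Qed.

Let card_T beta : #|T beta| = r.
Proof.
rewrite cardsE (card_uniqP _) ?take_uniq ?rho_uniq //.
by rewrite size_takel // size_rho leq_addl.
Qed.

Let historyE (i : 'I_(k * m)) :
  history p ((p^-1)%g i) = rcons (take ((p^-1)%g i) order) i.
Proof.
rewrite /history map_take (take_nth i) ?size_order ?ltn_ord //.
by rewrite (nth_map i) ?size_enum_ord ?ltn_ord // nth_ord_enum permKV.
Qed.

Let reveal_history (i : 'I_(k * m)) :
  let: (beta, u) := pos_block i in
  reveal beta (history p ((p^-1)%g i)) = take (index u (rho beta)).+1 (rho beta).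
Proof.
case pi: (pos_block i) => [beta u].
have order_cat : order = history p ((p^-1)%g i) ++ drop ((p^-1)%g i).+1 order.
  by rewrite /history map_take cat_take_drop.
set h := history _ _ in order_cat *.
have rev_h: reveal beta h = rcons (reveal beta (take ((p^-1)%g i) order)) u.
  by rewrite /h historyE /reveal filter_rcons pi eqxx map_rcons pi.
have rho_cat: rho beta = reveal beta h ++ reveal beta (drop ((p^-1)%g i).+1 order).
  by rewrite /rho order_cat /reveal filter_cat map_cat -order_cat.
have := rho_uniq beta; rewrite rho_cat rev_h.
set s := reveal _ _; rewrite cat_uniq rcons_uniq => /andP[/andP[us _] _].
(* As [rho beta] has no repetition, [u] is not in [s], so its index is exactly [size s]. *)
rewrite index_cat mem_rcons mem_head -cats1 index_cat (negPf us) /= eqxx addn0.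
by rewrite -catA take_cat ltnNge leqnSn /= subSnn /= take0.
Qed.

(** One formula covers both phases of Alice's play: the zeros written at first agree with
    [phi (T beta)], which vanishes on [T beta], and later the first [r] revealed coordinates
    determine [T beta]. *)
Let gksE (i : 'I_(k * m)) : i != i0 ->
  let: (beta, u) := pos_block i in
  x i = phi (T beta) u (+) ((index u (rho beta)).+1 == m).
Proof.
move=> neq_i; case pi: (pos_block i) => [beta u]; rewrite ffunE /=.
case: ifP => [/eqP eq_last|_].
  case/eqP: neq_i; apply: (@perm_inj _ p^-1%g); apply: val_inj.
  exact: etrans eq_last (esym i0_last).
have hidx: index u (rho beta) < m by rewrite -[X in _ < X](size_rho beta) index_mem.
have := reveal_history i; rewrite pi => hrev.
have size_rev: size (reveal beta (history p ((p^-1)%g i))) = (index u (rho beta)).+1.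
  by rewrite hrev size_takel ?size_rho.
have hist: history p ((p^-1)%g i) != [::] by rewrite historyE; case: take.
have hlast: last i (history p ((p^-1)%g i)) = i by rewrite historyE last_rcons.
rewrite /alice; case eqh: (history _ _) hist hlast => [//|i1 h] _ /= ->.
rewrite pi -eqh size_rev; case: ltnP => [le_r|gt_r].
  (* Early phase: [u] lies in [T beta], and [k > 0] gives [r < m], so no flip occurs here. *)
  rewrite phi_vanish ?card_T //; last first.
    by rewrite inE in_take ?mem_rho.
  by rewrite ltn_eqF // (leq_ltn_trans le_r) // -addn1 addnC leq_add2r.
by rewrite hrev take_takel // ltnW.
Qed.

Let last_rho beta : 'I_m := nth dflt (rho beta) m.-1.

Let m_gt0 : 0 < m.
Proof. by rewrite addn_gt0 k_gt0. Qed.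

Let index_last beta u : ((index u (rho beta)).+1 == m) = (u == last_rho beta).
Proof.
rewrite -[X in _ == X](prednK m_gt0) eqSS; apply/eqP/eqP => [eqi|->].
  by rewrite /last_rho -eqi nth_index.
by rewrite index_uniq ?rho_uniq // size_rho prednK.
Qed.

(** The last index [m.-1] is at least [r] because [k > 0]. *)
Let last_notin_T beta : last_rho beta \notin T beta.
Proof.
rewrite inE in_take ?mem_rho // -leqNgt.
have /eqP[->] : (index (last_rho beta) (rho beta)).+1 == (m.-1).+1.
  by rewrite prednK // index_last.
by rewrite -ltnS prednK // -add1n leq_add2r.
Qed.

(** At Merlin's step the history is the whole ordering, so every coordinate of his block has been
    revealed. *)
Let i0E : pos_block i0 = ((pos_block i0).1, last_rho (pos_block i0).1).
Proof.
rewrite [LHS]surjective_pairing; congr pair; apply/eqP; rewrite -index_last.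
have := reveal_history i0; case pi: (pos_block i0) => [beta u] /= hrev.
have hall: history p ((p^-1)%g i0) = order.
  rewrite /history map_take i0_last prednK ?muln_gt0 ?k_gt0 ?m_gt0 //.
  by rewrite take_oversize // size_order.
move/(congr1 size): hrev; rewrite hall size_takel ?index_mem // => <-.
by rewrite [X in X == _](size_rho beta).
Qed.

Let blockxE beta : beta != (pos_block i0).1 ->
  block x beta = flip (last_rho beta) (phi (T beta)).
Proof.
move=> neq_beta; apply/ffunP=> u; have [g fK gK] := pos_block_bij.
have eqg: pos_block (g (beta, u)) = (beta, u) by rewrite gK.
have := blockE x (g (beta, u)); rewrite eqg /= => ->.
have /gksE: g (beta, u) != i0.
  by apply: contraNneq neq_beta => <-; rewrite eqg.
by rewrite eqg => ->; rewrite index_last ffunE.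
Qed.

(** Only the last bit of this block is Merlin's; it either agrees with the codeword or is its
    negation. *)
Let blockx0E (beta := (pos_block i0).1) :
  block x beta = phi (T beta) \/
  block x beta = flip (last_rho beta) (phi (T beta)).
Proof.
have [g fK gK] := pos_block_bij.
have xother u : u != last_rho beta -> block x beta u = phi (T beta) u.
  move=> neq_u; have eqg: pos_block (g (beta, u)) = (beta, u) by rewrite gK.
  have := blockE x (g (beta, u)); rewrite eqg /= => ->.
  have /gksE: g (beta, u) != i0.
    by apply: contraNneq neq_u => eqi; move: eqg; rewrite eqi i0E => -[->].
  by rewrite eqg => ->; rewrite index_last (negPf neq_u) addbF.
case eq_last: (block x beta (last_rho beta) == phi (T beta) (last_rho beta)).
  by left; apply/ffunP=> u; have [->|/xother//] := eqVneq u (last_rho beta);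
    apply/eqP.
right; apply/ffunP=> u; rewrite [RHS]ffunE.
have [->|/xother->] := eqVneq u (last_rho beta); last by rewrite addbF.
by move/negbT: eq_last; case: (block _ _ _); case: (phi _ _).
Qed.

Lemma bob_wins : i0 \in bob x.
Proof.
(* A codeword can appear only in Merlin's block, and it identifies [T beta] there. *)
have code_block beta (T' : {set 'I_m}) : #|T'| = r -> block x beta = phi T' ->
    beta = (pos_block i0).1 /\ T' = T beta.
  move=> hT' eq_phi; have [eqb|neqb] := eqVneq beta (pos_block i0).1; last first.
    by have := flip_not_code (last_rho beta) (card_T beta) hT';
      rewrite -blockxE // eq_phi eqxx.
  split=> //; have [] := blockx0E; rewrite -eqb eq_phi.
    exact: phi_inj.
  by move/eqP; rewrite eq_sym (negPf (flip_not_code _ (card_T _) hT')).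
rewrite /bob; case: pickP => [[beta T'] /= /andP[/eqP hT' /eqP eq_phi]|no_code].
  have [-> ->] := code_block _ _ hT' eq_phi.
  by rewrite inE eqxx [in X in X.2]i0E last_notin_T.
(* With no codeword present, Merlin's bit acts as the flip Alice would have made. *)
rewrite inE [in X in X.2 == _]i0E /=; have [eq_phi|->] := blockx0E.
  have := no_code ((pos_block i0).1, T (pos_block i0).1).
  by rewrite /= card_T eq_phi !eqxx.
by rewrite decode_flip ?card_T.
Qed.

End Play.

Theorem block_strategy : has_strategy k (k * m).
Proof.
exists alice, bob; split; first exact: card_bob.
by move=> p b i; apply: bob_wins.
Qed.

End Blocks.

(** * Codewords of length 12 and their greedy matching with triples *)

Fixpoint words (n : nat) : seq bitseq :=
  if n is n'.+1 then map (cons true) (words n') ++ map (cons false) (words n')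
  else [:: [::]].

Lemma mem_words (s : bitseq) : s \in words (size s).
Proof.
elim: s => [|c s IHs] //=; rewrite mem_cat.
by case: c; rewrite map_f ?orbT.
Qed.

(* The columns of the parity-check matrix are the binary expansions of
   1, ..., 12. *)
Definition hamming_word (w : bitseq) : bool :=
  all (fun j => ~~ odd (count (fun i => nth false w i && odd (i.+1 %/ 2 ^ j))
                              (iota 0 12)))
      (iota 0 4).

Definition overlap (w w' : bitseq) : bool :=
  has (fun i => nth false w i && nth false w' i) (iota 0 12).

Definition hamming_dist (w w' : bitseq) : nat :=
  count (fun i => nth false w i != nth false w' i) (iota 0 12).

Fixpoint greedy_match (ts cs : seq bitseq) : seq bitseq :=
  if ts is t :: ts' then
    let c := head [::] [seq c <- cs | ~~ overlap t c] in
    c :: greedy_match ts' (rem c cs)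
  else [::].

(* The orders in which triples and codewords are enumerated matter: in some
   other orders the greedy matching gets stuck. *)
Definition triples : seq bitseq := rev [seq w <- words 12 | count id w == 3].

Definition triple_words : seq bitseq :=
  greedy_match triples [seq w <- words 12 | hamming_word w].

(** Nothing is proved about the greedy procedure itself: its output is checked by computation. The
    distance bound also makes the chosen words distinct. *)
Lemma triple_words_correct :
  all2 (fun t c => ~~ overlap t c) triples triple_words &&
  pairwise (fun c c' => 2 < hamming_dist c c') triple_words.
Proof. by vm_compute. Qed.

(** * From the computed lists to words attached to sets *)

Definition matched (ts cs : seq bitseq) (t : bitseq) : bitseq :=
  nth [::] cs (index t ts).

Lemma matched_all2 (P : bitseq -> bitseq -> bool) (ts cs : seq bitseq) (t : bitseq) :
  all2 P ts cs -> t \in ts -> P t (matched ts cs t).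
Proof.
rewrite all2E => /andP[/eqP eq_size /(all_nthP ([::], [::])) all_P] ht.
have := all_P (index t ts); rewrite size_zip -eq_size minnn index_mem => /(_ ht).
by rewrite nth_zip //= nth_index.
Qed.

(** [pairwise] compares earlier entries with later ones only; symmetry handles the reverse order. *)
Lemma matched_pairwise (r : rel bitseq) (ts cs : seq bitseq) : symmetric r ->
  size ts = size cs -> pairwise r cs ->
  {in ts &, forall t t', t != t' -> r (matched ts cs t) (matched ts cs t')}.
Proof.
move=> sym_r eq_size /(pairwiseP [::]) pair_r t t' ht ht' neq_t.
have in_cs u : u \in ts -> index u ts \in gtn (size cs).
  by rewrite inE -eq_size index_mem.
case: (ltngtP (index t ts) (index t' ts)) => [lt_t|gt_t|eq_t].
- exact: (pair_r _ _ (in_cs _ ht) (in_cs _ ht')).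
- by rewrite sym_r; apply: (pair_r _ _ (in_cs _ ht') (in_cs _ ht)).
- by case/eqP: neq_t; rewrite -(nth_index [::] ht) eq_t nth_index.
Qed.

Definition indicator (T : {set 'I_12}) : bitseq := [seq i \in T | i <- enum 'I_12].

Definition ffun_word (w : bitseq) : {ffun 'I_12 -> bool} :=
  [ffun i : 'I_12 => nth false w i].

(** On sets that are not triples the lookup returns the default [[::]], read as the zero word. *)
Definition triple_word (T : {set 'I_12}) : {ffun 'I_12 -> bool} :=
  ffun_word (matched triples triple_words (indicator T)).

Lemma nth_indicator (T : {set 'I_12}) (i : 'I_12) :
  nth false (indicator T) i = (i \in T).
Proof. by rewrite (nth_map i) ?size_enum_ord ?ltn_ord // nth_ord_enum. Qed.

Lemma indicator_inj : injective indicator.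
Proof. by move=> T T' eqT; apply/setP=> i; rewrite -!nth_indicator eqT. Qed.

Lemma mem_triples (T : {set 'I_12}) : #|T| = 3 -> indicator T \in triples.
Proof.
move=> hT; rewrite mem_rev mem_filter.
have size_ind: size (indicator T) = 12 by rewrite size_map size_enum_ord.
have := mem_words (indicator T); rewrite size_ind => ->; rewrite andbT.
by rewrite -[X in _ == X]hT cardE count_map -size_filter enumT.
Qed.

Lemma card_count_iota (n : nat) (P : pred nat) :
  #|[set i : 'I_n | P i]| = count P (iota 0 n).
Proof.
rewrite cardsE cardE -[in RHS]val_enum_ord count_map -size_filter.
by rewrite enumT.
Qed.

Lemma card_diff_ffun_word (w w' : bitseq) :
  #|[set i | ffun_word w i != ffun_word w' i]| = hamming_dist w w'.
Proof.
rewrite /hamming_dist -card_count_iota.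
by apply: eq_card => i; rewrite !inE !ffunE.
Qed.

Lemma triple_word_vanish (T : {set 'I_12}) :
  #|T| = 3 -> {in T, forall i, triple_word T i = false}.
Proof.
move=> /mem_triples hT i iT; rewrite ffunE.
have /andP[all_disj _] := triple_words_correct.
move: (matched_all2 all_disj hT) => /hasPn /(_ (val i)).
by rewrite mem_iota ltn_ord nth_indicator iT => /(_ isT)/negPf.
Qed.

Lemma triple_word_dist (T T' : {set 'I_12}) : #|T| = 3 -> #|T'| = 3 ->
  T != T' -> 2 < #|[set i | triple_word T i != triple_word T' i]|.
Proof.
move=> /mem_triples hT /mem_triples hT' neqT.
have /andP[all_disj pair_dist] := triple_words_correct.
have eq_size: size triples = size triple_words.
  by move: all_disj; rewrite all2E => /andP[/eqP].
have sym_dist: symmetric (fun c c' => 2 < hamming_dist c c').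
  by move=> c c'; congr (2 < _); apply: eq_count => i; rewrite eq_sym.
have := matched_pairwise sym_dist eq_size pair_dist hT hT'.
by rewrite (inj_eq indicator_inj) card_diff_ffun_word; apply.
Qed.

Theorem theorem2 : has_strategy 9 108.
Proof.
(* Here [108 = 9 * (9 + 3)] holds by computation, and [isT] proves [0 < 9]. *)
exact: (@block_strategy 9 3 triple_word isT triple_word_vanish triple_word_dist).
Qed.
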